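(* Let $\widehat{a}=a+\varepsilon b$ and $\widehat{c}=c+\varepsilon d$ be dual numbers, $a,b,c,d\in\mathbb{R}$, with none of $a$, $c$, $a+c$ in $\{0,-1,-2,\dots\}$. Then $$\beta_d(\widehat{a},\widehat{c})=\frac{\Gamma_d(\widehat{a})\,\Gamma_d(\widehat{c})}{\Gamma_d(\widehat{a}+\widehat{c})}.$$
   Context: Dual numbers are $\widehat{x}=x_1+\varepsilon x_2$, $x_1,x_2\in\mathbb{R}$, $\varepsilon^2=0$, forming the commutative ring $\mathbb{R}[\varepsilon]/(\varepsilon^2)$; division by $\widehat{x}$ is possible iff $x_1\ne0$. For real $t>0$, $t^{a+\varepsilon b}=t^a(1+\varepsilon b\log t)$. The dual gamma function is $\Gamma_d(a+\varepsilon b)=\Gamma(a)+\varepsilon b\,\Gamma'(a)$ for $a\ne0,-1,-2,\dots$ (for $a>0$ this equals $\int_0^\infty e^{-t}t^{\widehat{a}-1}dt$). The dual beta function is $\beta_d(\widehat{a},\widehat{c})=\int_0^1 t^{\widehat{a}-1}(1-t)^{\widehat{c}-1}\,dt$ for $a,c>0$ (integrating real and dual parts), which equals $\beta(a,c)+\varepsilon b\,\frac{\partial}{\partial a}\beta(a,c)+\varepsilon d\,\frac{\partial}{\partial c}\beta(a,c)$; for other real $a,c\notin\{0,-1,-2,\dots\}$ it is defined by this last formula, with the classical beta function $\beta(a,c)=\Gamma(a)\Gamma(c)/\Gamma(a+c)$. *)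

(* Defs.v *)
From HB Require Import structures.
From mathcomp Require Import all_boot all_order all_algebra.
From mathcomp Require Import all_classical all_reals all_analysis.

Set Implicit Arguments.
Unset Strict Implicit.
Unset Printing Implicit Defensive.

Import Order.TTheory GRing.Theory Num.Theory.
Import numFieldNormedType.Exports.

Local Open Scope classical_set_scope.
Local Open Scope ring_scope.

(* [Dual a b] is the dual number a + eps b, with eps ^ 2 = 0. *)
Record dual (R : Type) : Type := Dual { re : R; du : R }.

Section DualChoice.
Variable R : choiceType.

Definition pair_of_dual (x : dual R) : R * R := (re x, du x).
Definition dual_of_pair (p : R * R) : dual R := Dual p.1 p.2.

Lemma pair_of_dualK : cancel pair_of_dual dual_of_pair.
Proof. by case. Qed.

HB.instance Definition _ := Choice.copy (dual R) (can_type pair_of_dualK).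

End DualChoice.

Section DualRing.
Variable R : fieldType.
Implicit Types x y z : dual R.

Definition dual_add x y := Dual (re x + re y) (du x + du y).
Definition dual_opp x := Dual (- re x) (- du x).
Definition dual_mul x y := Dual (re x * re y) (re x * du y + du x * re y).
Definition dual_unit : {pred dual R} := fun x => re x != 0.
(* As the ring structures require, the inverse is the identity on non-units. *)
Definition dual_inv x :=
  if re x != 0 then Dual (re x)^-1 (- du x / re x ^+ 2) else x.

Lemma dual_addA : associative dual_add.
Proof. by move=> x y z; rewrite /dual_add /= !addrA. Qed.

Lemma dual_addC : commutative dual_add.
Proof. by move=> x y; rewrite /dual_add addrC [du x + _]addrC. Qed.

Lemma dual_add0 : left_id (Dual 0 0) dual_add.
Proof. by case=> a b; rewrite /dual_add /= !add0r. Qed.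

Lemma dual_addN : left_inverse (Dual 0 0) dual_opp dual_add.
Proof. by case=> a b; rewrite /dual_add /= !addNr. Qed.

HB.instance Definition _ :=
  GRing.isZmodule.Build (dual R) dual_addA dual_addC dual_add0 dual_addN.

Lemma dual_mulA : associative dual_mul.
Proof.
by move=> x y z; rewrite /dual_mul /= mulrDr mulrDl !mulrA addrA.
Qed.

Lemma dual_mulC : commutative dual_mul.
Proof.
move=> x y; rewrite /dual_mul mulrC addrC.
by rewrite [du x * _]mulrC [re x * du y]mulrC.
Qed.

Lemma dual_mul1 : left_id (Dual 1 0) dual_mul.
Proof. by case=> a b; rewrite /dual_mul /= !mul1r mul0r addr0. Qed.

Lemma dual_mulDl : left_distributive dual_mul +%R.
Proof.
by move=> x y z; congr Dual; rewrite /= !mulrDl // addrACA.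
Qed.

Lemma dual_oner_neq0 : Dual 1 0 != 0 :> dual R.
Proof. by apply/eqP => -[] /eqP; rewrite oner_eq0. Qed.

HB.instance Definition _ := GRing.Zmodule_isComNzRing.Build (dual R)
  dual_mulA dual_mulC dual_mul1 dual_mulDl dual_oner_neq0.

Lemma dual_mulVx : {in dual_unit, left_inverse 1 dual_inv *%R}.
Proof.
move=> x; rewrite unfold_in /dual_unit => x0; rewrite /dual_inv x0.
congr Dual => /=; first by rewrite mulVf.
by rewrite expr2 invfM mulrA mulfVK // mulNr [du x / _]mulrC subrr.
Qed.

Lemma dual_unitPl x y : y * x = 1 -> x \in dual_unit.
Proof.
move=> [h _]; rewrite unfold_in /dual_unit; apply/eqP => x0; move: h.
by rewrite x0 mulr0 => /esym/eqP; rewrite oner_eq0.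
Qed.

Lemma dual_inv_out : {in [predC dual_unit], dual_inv =1 id}.
Proof.
by move=> x; rewrite inE /= unfold_in /dual_unit /dual_inv => /negbTE ->.
Qed.

HB.instance Definition _ := GRing.ComNzRing_hasMulInverse.Build (dual R)
  dual_mulVx dual_unitPl dual_inv_out.

End DualRing.

Section DualSpecialFunctions.
Variable R : realType.
Local Notation mu := (@lebesgue_measure R).

(* Euler's integral, meaningful only for x > 0. *)
Definition euler_gamma (x : R) : R :=
  \int[mu]_(t in `]0, +oo[) (expR (- t) * t `^ (x - 1)).

(* The real gamma function, extended from x > 0 by the functional equation
   Gamma (x + 1) = x * Gamma x. The shift [gamma_shift x] is 0 when x > 0 and
   always satisfies x + gamma_shift x > 0; the value at the poles is
   irrelevant. *)
Definition gamma_shift (x : R) : nat := Num.truncn (1 - x).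

Definition gamma (x : R) : R :=
  euler_gamma (x + (gamma_shift x)%:R) / \prod_(k < gamma_shift x) (x + k%:R).

Definition beta (x y : R) : R := gamma x * gamma y / gamma (x + y).

Definition gamma_pole (x : R) : Prop := exists n : nat, x = - n%:R.

Definition dual_gamma (x : dual R) : dual R :=
  Dual (gamma (re x)) (du x * derive1 gamma (re x)).

(* The power t ^ x of a real t > 0 to a dual exponent x. *)
Definition dual_powR (t : R) (x : dual R) : dual R :=
  Dual (t `^ re x) (t `^ re x * (du x * ln t)).

Definition dual_integral (D : set R) (f : R -> dual R) : dual R :=
  Dual (\int[mu]_(t in D) re (f t)) (\int[mu]_(t in D) du (f t)).

Definition dual_beta (x y : dual R) : dual R :=
  if (0 < re x) && (0 < re y) then
    dual_integral `]0, 1[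
      (fun t => dual_powR t (x - 1) * dual_powR (1 - t) (y - 1))
  else
    Dual (beta (re x) (re y))
         (du x * derive1 (fun s => beta s (re y)) (re x) +
          du y * derive1 (fun s => beta (re x) s) (re y)).

End DualSpecialFunctions.

(* Main.v *)
Require Import Defs.
From mathcomp Require Import all_boot all_order all_algebra.
From mathcomp Require Import all_classical all_reals all_analysis.
From mathcomp Require Import measurable_realfun ring lra.

Set Implicit Arguments.
Unset Strict Implicit.
Unset Printing Implicit Defensive.

Import Order.TTheory GRing.Theory Num.Theory.
Import numFieldNormedType.Exports.

Local Open Scope classical_set_scope.
Local Open Scope ring_scope.

(** Both sides are dual numbers, and equality of the real parts is the classical
    Beta(a, c) Gamma(a + c) = Gamma(a) Gamma(c). The dual part of either side is
    the derivative of its real part in the direction (b, d): on the right this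
    is the quotient rule, which only needs Gamma to be differentiable and
    nonzero at the points involved ([derivable_gamma], [gamma_neq0],
    [derive1_beta]); on the left it is the definition when a or c is negative.

    When a and c are positive, the left-hand side is instead given by integrals
    over ]0, 1[, and two analytic facts bring it to the same form
    ([dual_betaE]). The first is that the integral of t^(a-1) (1-t)^(c-1)
    converges to Gamma(a) Gamma(c) / Gamma(a + c): in the product of the two
    Euler integrals, Tonelli's theorem and the substitution (s, t) to
    (s, u = s + t) turn the inner integral into the convolution of two powers,
    which by scaling equals u^(a+c-1) times the Beta integral
    ([gamma_gamma_beta]). The second is that integrals depending on a parameter
    through an exponent can be differentiated under the integral sign wherever
    they converge on a neighbourhood of the parameter
    ([is_derive_integral_powR]). The latter gives the derivative of Gamma as
    well as both logarithmic Beta integrals. *)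

(** * Differentiation in the exponent under the integral sign *)

Section ExponentialIntegrals.
Context {R : realType} d {T : measurableType d} {mu : {measure set T -> \bar R}}.

(** A factor [l] costs at most an arbitrarily small change of the exponent, up or
    down according to the sign of [l]. The bound does not depend on [s], so it
    serves as a dominating function. *)
Lemma norm_mul_expR_le (a e s l : R) : 0 < e -> a - e < s < a + e ->
  `|l * expR (s * l)| <=
  e^-1 * (expR ((a + 2 * e) * l) + expR ((a - 2 * e) * l)).
Proof.
move=> e0 /andP[ls su].
rewrite ler_pdivlMl// normrM (ger0_norm (expR_ge0 _)) mulrA.
have el : e * `|l| <= expR (e * `|l|).
  by apply: le_trans (expR_ge1Dx _); rewrite lerDr.
apply: (@le_trans _ _ (expR (e * `|l|) * expR (s * l))).
  by rewrite ler_wpM2r// expR_ge0.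
rewrite -expRD.
have [l0|l0] := leP 0 l.
  apply: (@le_trans _ _ (expR ((a + 2 * e) * l))); last first.
    by rewrite lerDl expR_ge0.
  by rewrite ler_expR (ger0_norm l0); nra.
apply: (@le_trans _ _ (expR ((a - 2 * e) * l))); last first.
  by rewrite lerDr expR_ge0.
by rewrite ler_expR (ltr0_norm l0); nra.
Qed.

(** A Laplace transform is differentiable under the integral sign in the interior
    of its interval of convergence: its integrands at two points on either side
    of [a] dominate the derivatives of all integrands near [a]. *)
Lemma is_derive_integral_expR (D : set T) (g l : T -> R) (a u v : R) :
  measurable D -> measurable_fun D l -> u < a < v ->
  (forall s, u < s < v ->
    mu.-integrable D (EFin \o (fun y => expR (s * l y) * g y))) ->
  mu.-integrable D (EFin \o (fun y => l y * expR (a * l y) * g y)) /\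
  is_derive a 1 (fun s => \int[mu]_(y in D) (expR (s * l y) * g y))
    (\int[mu]_(y in D) (l y * expR (a * l y) * g y)).
Proof.
move=> mD ml /andP[ua av] intf.
(* A step such that a + 2 e and a - 2 e still lie in the interval. *)
pose e := Num.min (a - u) (v - a) / 3.
have e0 : 0 < e by rewrite divr_gt0// lt_min !subr_gt0 ua av.
have eu : u < a - 2 * e.
  have : 3 * e <= a - u by rewrite /e mulrC divfK// ge_min lexx.
  by lra.
have ev : a + 2 * e < v.
  have : 3 * e <= v - a by rewrite /e mulrC divfK// ge_min lexx orbT.
  by lra.
pose f s y := expR (s * l y) * g y.
pose G y := e^-1 * (`|f (a + 2 * e) y| + `|f (a - 2 * e) y|).
have df (s : R) (y : T) : is_derive s 1 (f ^~ y) (l y * expR (s * l y) * g y).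
  have dl : is_derive s 1 (fun r : R => r * l y) (l y).
    rewrite -[X in is_derive _ _ _ X]mulr1.
    rewrite (_ : (fun r : R => r * l y) = (fun r : R => l y *: r)).
      exact: is_deriveZ.
    by apply/funext => r; rewrite /GRing.scale/= mulrC.
  have -> : f ^~ y = (fun r : R => g y *: (expR \o (fun r => r * l y)) r).
    by apply/funext => r; rewrite /f /GRing.scale/= mulrC.
  rewrite (_ : l y * _ * _ = g y *: (expR (s * l y) * l y)).
    by apply: is_deriveZ; exact: is_derive1_comp.
  by rewrite /GRing.scale/= mulrC (mulrC (l y)).
have d1f s y : partial1of2 f s y = l y * expR (s * l y) * g y.
  by rewrite partial1of2E; exact: derive_val.
have intG : mu.-integrable D (EFin \o G).
  apply: (@eq_integrable _ _ _ mu D mD (fun y =>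
    e^-1%:E * ((`|(f (a + 2 * e) y)%:E| + `|(f (a - 2 * e) y)%:E|)))%E).
    by move=> y _; rewrite /G /= EFinM.
  apply: integrableZl => //.
  by apply: integrableD => //; apply: integrable_abse; apply: intf; lra.
have lefG s y : a - e < s < a + e -> `|l y * expR (s * l y) * g y| <= G y.
  move=> hs; rewrite normrM /G /f !normrM !(ger0_norm (expR_ge0 _)) -mulrDl mulrA.
  by rewrite ler_wpM2r//; have := norm_mul_expR_le (l y) e0 hs; rewrite normrM (ger0_norm (expR_ge0 _)).
have aI : `]a - e, a + e[%classic a by rewrite /= in_itv/=; lra.
have mf : measurable_fun D (fun y => l y * expR (a * l y) * g y).
  have /integrableP[/measurable_EFinP mfa _] : mu.-integrable D (EFin \o f a).
    by apply: intf; lra.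
  rewrite (_ : (fun y => _) = (fun y => l y * f a y)).
    exact: measurable_funM.
  by apply/funext => y; rewrite /f mulrA.
have int' : mu.-integrable D (EFin \o (fun y => l y * expR (a * l y) * g y)).
  apply: le_integrable intG => //=; first exact/measurable_EFinP.
  move=> y Dy; rewrite lee_fin.
  by apply: le_trans (ler_norm _); apply: lefG; lra.
split=> //.
have G0 y : 0 <= G y by rewrite mulr_ge0 ?invr_ge0 ?(ltW e0)// addr_ge0.
have intI x : `]a - e, a + e[%classic x -> mu.-integrable D (EFin \o f x).
  by rewrite /= in_itv/= => ?; apply: intf; lra.
have derI x y : `]a - e, a + e[%classic x -> D y -> derivable (f ^~ y) x 1.
  by move=> _ _; exact: ex_derive.
have ubI x y : `]a - e, a + e[%classic x -> D y -> `|partial1of2 f x y| <= G y.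
  by rewrite /= in_itv/= => ? _; rewrite d1f lefG.
apply: DeriveDef.
  exact: (derivable_under_integral mD aI intI derI G0 intG ubI).
rewrite -derive1E (differentiation_under_integral mD aI intI derI G0 intG ubI).
by apply: eq_Rintegral => y _; rewrite d1f.
Qed.

(** The same for a Mellin transform, which is a Laplace transform in [ln w]. The
    exponents are shifted by one as in Euler's integrals. *)
Lemma is_derive_integral_powR (D : set T) (g w : T -> R) (a u v : R) :
  measurable D -> measurable_fun D w -> (forall y, D y -> 0 < w y) ->
  u < a < v ->
  (forall s, u < s < v ->
    mu.-integrable D (EFin \o (fun y => w y `^ (s - 1) * g y))) ->
  mu.-integrable D (EFin \o (fun y => w y `^ (a - 1) * ln (w y) * g y)) /\
  is_derive a 1 (fun s => \int[mu]_(y in D) (w y `^ (s - 1) * g y))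
    (\int[mu]_(y in D) (w y `^ (a - 1) * ln (w y) * g y)).
Proof.
move=> mD mw w0 auv intw.
have powE s y : y \in D ->
    w y `^ (s - 1) * g y = expR (s * ln (w y)) * (g y / w y).
  rewrite inE => /w0 wy; rewrite powRB ?(gt_eqF wy) ?implybT// powRr1 ?ltW//.
  by rewrite /powR gt_eqF//; ring.
have powlnE y : y \in D -> w y `^ (a - 1) * ln (w y) * g y =
    ln (w y) * expR (a * ln (w y)) * (g y / w y).
  by move=> Dy; rewrite mulrAC powE//; ring.
have [| |int' der'] := @is_derive_integral_expR D (fun y => g y / w y)
    (fun y => ln (w y)) a u v mD _ auv.
- exact: measurableT_comp.
- move=> s /intw; apply: eq_integrable => // y Dy.
  by rewrite /= powE.
split.
  by apply: eq_integrable int' => // y Dy; rewrite /= powlnE.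
rewrite (eq_Rintegral _ powlnE).
rewrite (_ : (fun s => _) = (fun s =>
  \int[mu]_(y in D) (expR (s * ln (w y)) * (g y / w y)))) //.
by apply/funext => s; apply: eq_Rintegral => y; exact: powE.
Qed.

End ExponentialIntegrals.

(** * Euler's integral for Gamma *)

Section EulerGamma.
Context {R : realType}.
Local Notation mu := (@lebesgue_measure R).

Lemma measurable_powR_shift (x : R) (D : set R) :
  measurable_fun D (fun t : R => t `^ (x - 1)).
Proof. exact: measurable_funTS (measurable_powR _). Qed.

Lemma integral_itvcc_powR (e x : R) : 0 < e < 1 -> 0 < x ->
  (\int[mu]_(t in `[e, 1%R]) (t `^ (x - 1))%:E = (x^-1 * (1 - e `^ x))%:E)%E.
Proof.
move=> /andP[e0 e1] x0.
pose F (t : R) := x^-1 * t `^ x.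
have dF (t : R) : 0 < t -> is_derive t 1 F (t `^ (x - 1)).
  move=> t0; have := is_deriveZ x^-1 (is_derive1_powR x t0).
  by rewrite /GRing.scale/= mulKf// gt_eqF.
have cF (t : R) : 0 < t -> {for t, continuous F}.
  move=> t0; apply: differentiable_continuous; apply/derivable1_diffP.
  by have [] := dF t t0.
rewrite (@continuous_FTC2 _ _ F)//.
- by rewrite /F powR1 mulr1 -EFinB mulrBr mulr1.
- apply: continuous_in_subspaceT => t; rewrite inE/= in_itv/= => /andP[et _].
  have t0 : 0 < t by exact: lt_le_trans et.
  apply: differentiable_continuous; apply/derivable1_diffP.
  by have [] := is_derive1_powR (x - 1) t0.
- split.
  + move=> t; rewrite in_itv/= => /andP[et _].
    by have [] := dF t (lt_trans e0 et).
  + exact: cvg_at_right_filter (cF _ e0).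
  + exact: cvg_at_left_filter (cF _ ltr01).
- move=> t; rewrite in_itv/= => /andP[et _].
  by rewrite derive1E; have [_ ->] := dF t (lt_trans e0 et).
Qed.

(** The integrand may be unbounded at 0, so the fundamental theorem of calculus
    is used on the intervals [1/(n+2), 1], where it bounds the integral by
    1/x, and these intervals exhaust ]0, 1]. *)
Lemma integral_itvoc_powR_lty (x : R) : 0 < x ->
  (\int[mu]_(t in `]0%R, 1%R]) (t `^ (x - 1))%:E < +oo)%E.
Proof.
move=> x0; pose I (n : nat) := `[n.+2%:R^-1 : R, 1]%classic.
have -> : `]0%R, 1%R]%classic = \bigcup_n I n.
  apply/seteqP; split=> t /=.
    rewrite in_itv/= => /andP[t0 t1].
    exists (Num.truncn t^-1) => //; rewrite /I/= in_itv/= t1 andbT.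
    rewrite -[leRHS]invrK lef_pV2 ?posrE ?invr_gt0//.
    by rewrite (le_trans (ltW (truncnS_gt _)))// ler_nat.
  move=> [n _]; rewrite /I/= !in_itv/= => /andP[nt ->]; rewrite andbT.
  by apply: lt_le_trans nt; rewrite invr_gt0.
have ndI : nondecreasing_seq I.
  move=> m n mn; apply/subsetPset => t; rewrite /I/= !in_itv/= => /andP[+ ->].
  rewrite andbT; apply: le_trans.
  by rewrite lef_pV2 ?posrE// ler_nat !ltnS.
apply: (@le_lt_trans _ _ (x^-1)%:E); last exact: ltry.
have cvI : (\int[mu]_(t in I i) (t `^ (x - 1))%:E)%E @[i --> \oo] -->
    (\int[mu]_(t in \bigcup_i I i) (t `^ (x - 1))%:E)%E.
  apply: ge0_nondecreasing_set_cvg_integral => //.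
  - by move=> i; exact: measurable_itv.
  - by move=> i; apply/measurable_EFinP; exact: measurable_powR_shift.
  - by move=> i t _; rewrite lee_fin powR_ge0.
rewrite -(cvg_lim _ cvI)//; apply: lime_le; first by apply/cvg_ex; eexists; exact: cvI.
apply: nearW => n; rewrite /I integral_itvcc_powR//; last first.
  by rewrite invr_gt0 ltr0n/= invf_lt1// ltr1n.
by rewrite lee_fin ler_piMr ?invr_ge0 ?(ltW x0)// lerBlDr lerDl powR_ge0.
Qed.

(** This is 1 + y <= exp y at y = t / (2p), raised to the power p. *)
Lemma powR_le_expR (p t : R) : 0 < p -> 0 < t ->
  t `^ p <= (2 * p) `^ p * expR (2^-1 * t).
Proof.
move=> p0 t0.
have -> : 2^-1 * t = t / (2 * p) * p by field; rewrite gt_eqF.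
rewrite expRM -powRM ?expR_ge0//; last lra.
apply: ge0_ler_powR; rewrite ?nnegrE; [lra|lra|by rewrite mulr_ge0 ?expR_ge0//; lra|].
rewrite -ler_pdivrMl; last lra.
rewrite mulrC; apply: le_trans (expR_ge1Dx _); lra.
Qed.

(** On ]0, 1] the integrand is at most t^(x-1), and on ]1, +oo[ it is at most a
    multiple of the exponential density of rate 1/2. *)
Lemma integrable_euler_gamma (x : R) : 0 < x ->
  mu.-integrable `]0, +oo[ (EFin \o (fun t => expR (- t) * t `^ (x - 1))).
Proof.
move=> x0.
have mg : measurable_fun setT (fun t : R => expR (- t) * t `^ (x - 1)).
  apply: measurable_funM; last exact: measurable_powR_shift.
  by apply: measurableT_comp => //; exact: measurable_funN.
have g0 t : 0 <= expR (- t) * t `^ (x - 1).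
  by rewrite mulr_ge0 ?expR_ge0 ?powR_ge0.
apply/integrableP; split; first exact/measurable_EFinP/measurable_funTS.
under eq_integral do rewrite /= ger0_norm ?g0//.
have -> : `]0, +oo[%classic = `]0, 1] `|` `]1, +oo[ :> set R.
  by rewrite -itv_bndbnd_setU ?bnd_simp ?ler01.
rewrite ge0_integral_setU//=; first last.
- apply/disj_setPRL => t /=; rewrite !in_itv/= andbT => t1 /andP[_].
  by rewrite leNgt t1.
- by move=> t _; rewrite lee_fin.
- exact/measurable_EFinP/measurable_funTS.
apply: lte_add_pinfty.
  apply: le_lt_trans (integral_itvoc_powR_lty x0).
  apply: ge0_le_integral => //=.
  - by move=> t _; rewrite lee_fin.
  - exact/measurable_EFinP/measurable_funTS.
  - by apply/measurable_EFinP; exact: measurable_powR_shift.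
  - move=> t; rewrite in_itv/= => /andP[t0 _].
    by rewrite lee_fin ler_piMl ?powR_ge0// -expR0 ler_expR; lra.
pose p := `|x - 1| + 1.
have p0 : 0 < p by rewrite /p ltr_wpDl.
pose C := (2 * p) `^ p * 2.
have C0 : 0 <= C by rewrite mulr_ge0 ?powR_ge0.
apply: (@le_lt_trans _ _
    (\int[mu]_t (C%:E * (exponential_pdf (2^-1 : R) t)%:E)))%E; last first.
  rewrite ge0_integralZl//=.
  - by rewrite integral_exponential_pdf ?mule1 ?ltry.
  - by apply/measurable_EFinP; exact: measurable_exponential_pdf.
  - by move=> t _; rewrite lee_fin exponential_pdf_ge0.
apply: (@le_trans _ _
    (\int[mu]_(t in `]1%R, +oo[) (C%:E * (exponential_pdf (2^-1 : R) t)%:E)))%E.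
  apply: ge0_le_integral => //=.
  - by move=> t _; rewrite lee_fin.
  - exact/measurable_EFinP/measurable_funTS.
  - apply/measurable_EFinP; apply: measurable_funM => //.
    exact: measurable_funTS (measurable_exponential_pdf _).
  - move=> t; rewrite in_itv/= andbT => t1; have t0 : 0 < t by lra.
    rewrite exponential_pdfE ?(ltW t0)// -EFinM lee_fin /C.
    have -> : (2 * p) `^ p * 2 * (2^-1 * expR (- 2^-1 * t)) =
      expR (- t) * ((2 * p) `^ p * expR (2^-1 * t)).
      have -> : - 2^-1 * t = - t + 2^-1 * t by lra.
      by rewrite expRD; field.
    rewrite ler_wpM2l ?expR_ge0//; apply: le_trans (powR_le_expR p0 t0).
    by apply: ler_powR; rewrite ?(ltW t1)// /p ler_wpDr// ler_norm.
apply: ge0_subset_integral => //=.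
  apply/measurable_EFinP; apply: measurable_funM => //.
  exact: measurable_exponential_pdf.
by move=> t _; rewrite mule_ge0// lee_fin exponential_pdf_ge0.
Qed.

(** A vanishing integral would make the integrand vanish almost everywhere, but
    it is positive on a half-line. *)
Lemma euler_gamma_gt0 (x : R) : 0 < x -> 0 < euler_gamma x.
Proof.
move=> x0; have ig := integrable_euler_gamma x0.
rewrite lt0r /euler_gamma; apply/andP; split; last first.
  by apply: Rintegral_ge0 => t _; rewrite mulr_ge0 ?expR_ge0 ?powR_ge0.
apply/negP => /eqP i0.
have : (\int[mu]_(t in `]0%R, +oo[) `|(expR (- t) * t `^ (x - 1))%:E| = 0)%E.
  under eq_integral do rewrite gee0_abs ?lee_fin ?mulr_ge0 ?expR_ge0 ?powR_ge0//.
  have /fineK <- : (\int[mu]_(t in `]0%R, +oo[)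
      (expR (- t) * t `^ (x - 1))%:E)%E \is a fin_num.
    by apply: integrable_fin_num ig; exact: measurable_itv.
  by move: i0; rewrite /Rintegral => ->.
have /integrableP[mg _] := ig.
move/ae_eq_integral_abs => /(_ (measurable_itv _) mg) [N [mN N0 subN]].
have : (mu `]0%R, +oo[ <= mu N)%E.
  apply: le_measure; [rewrite inE; exact: measurable_itv|by rewrite inE|].
  move=> t t0; apply: subN => /= /(_ t0).
  move=> [] /eqP; apply/negP.
  move: t0; rewrite /= in_itv/= andbT => t0.
  by rewrite gt_eqF// mulr_gt0 ?expR_gt0 ?powR_gt0.
by rewrite N0 lebesgue_measure_itv/= ltry addye// leye_eq => /eqP.
Qed.

Lemma derivable_euler_gamma (x : R) : 0 < x -> derivable (@euler_gamma R) x 1.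
Proof.
move=> x0.
have [|s|||_ [+ _]] := @is_derive_integral_powR R _
    (measurableTypeR R) mu `]0, +oo[%classic (fun t => expR (- t)) idfun x
    0 (x + 1) (measurable_itv _).
- exact: measurable_id.
- by rewrite /= in_itv/= andbT.
- by lra.
- move=> s /andP[s0 _].
  apply: eq_integrable (integrable_euler_gamma s0) => //.
  by move=> t _; rewrite /= mulrC.
congr (derivable _ x 1); apply/funext => s.
by apply: eq_Rintegral => t _; rewrite mulrC.
Qed.

End EulerGamma.

(** * The Beta integral as a quotient of Gammas *)

Section LebesgueAffine.
Context {R : realType}.
Local Notation mu := (@lebesgue_measure R).

(** Lebesgue measure is its own image under a translation, since the two agree
    on half-open intervals. *)
Lemma ge0_integral_lebesgue_shift (f : R -> \bar R) (c : R) :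
  measurable_fun setT f -> (forall t, 0 <= f t)%E ->
  (\int[mu]_t f (t - c)%R = \int[mu]_t f t)%E.
Proof.
move=> mf f0.
pose phi (t : measurableTypeR R) : measurableTypeR R := (t - c)%R.
have mphi : measurable_fun setT phi by exact: measurable_funB.
rewrite -[LHS]/(\int[mu]_(t in phi @^-1` setT) (f \o phi) t)%E.
rewrite -ge0_integral_pushforward//.
apply: eq_measure_integral => A mA _; apply/esym.
apply: (lebesgue_measure_unique (mu := pushforward mu phi)) => //.
move=> _ [[a b]] _ <- /=.
have -> : pushforward mu phi `]a, b]%classic = mu `]a + c, b + c]%classic.
  congr (mu _).
  by apply/seteqP; split => t /=; rewrite !in_itv/= /phi ltrBrDr lerBlDr.
by rewrite !lebesgue_measure_itv/= !lte_fin ltrD2r -!EFinB opprD addrACA subrr addr0.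
Qed.

(** The image of Lebesgue measure under multiplication by [k], rescaled by [k],
    is again Lebesgue measure. *)
Lemma ge0_integral_lebesgue_scale (f : R -> \bar R) (k : R) : 0 < k ->
  measurable_fun setT f -> (forall t, 0 <= f t)%E ->
  (k%:E * \int[mu]_t f (k * t)%R = \int[mu]_t f t)%E.
Proof.
move=> k0 mf f0.
pose phi (t : measurableTypeR R) : measurableTypeR R := (k * t)%R.
have mphi : measurable_fun setT phi by exact: measurable_funM.
rewrite -[X in (_ * X)%E]/(\int[mu]_(t in phi @^-1` setT) (f \o phi) t)%E.
rewrite -ge0_integral_pushforward//.
pose K := NngNum (ltW k0).
rewrite -[k]/(K%:num) -ge0_integral_mscale//.
apply: eq_measure_integral => A mA _; apply/esym.
apply: (lebesgue_measure_unique (mu := mscale K (pushforward mu phi))) => //.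
move=> _ [[a b]] _ <- /=; rewrite /mscale/=.
have -> : pushforward mu phi `]a, b]%classic = mu `]a / k, b / k]%classic.
  congr (mu _).
  apply/seteqP; split => t /=; rewrite !in_itv/= /phi.
    by rewrite ltr_pdivrMr// ler_pdivlMr// mulrC.
  by rewrite ltr_pdivrMr// ler_pdivlMr// mulrC.
rewrite !lebesgue_measure_itv/= !lte_fin ltr_pM2r ?invr_gt0//.
case: ifPn => _; last by rewrite mule0.
by rewrite -!EFinB -EFinM; congr EFin; field; rewrite gt_eqF.
Qed.

End LebesgueAffine.

Section BetaGamma.
Context {R : realType}.
Local Notation mu := (@lebesgue_measure R).

(** The power t^(x-1) is cut off at 0 so that Euler's two integrals become
    integrals over the whole line, where translations and scalings act without
    changing the domain. The test matters because [powR] takes the value 1 at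
    negative bases. *)
Definition pospow (x t : R) : R := if 0 < t then t `^ (x - 1) else 0.

Lemma pospow_restrict x : pospow x = (fun t => t `^ (x - 1)) \_ `]0, +oo[.
Proof.
apply/funext => t; rewrite patchE mem_setE /= in_itv/= andbT.
by rewrite /pospow; case: ifP.
Qed.

Lemma measurable_pospow x : measurable_fun setT (pospow x).
Proof.
rewrite pospow_restrict; apply/measurable_restrict => //.
by rewrite setTI; exact: measurable_powR_shift.
Qed.

Lemma pospow_ge0 x t : 0 <= pospow x t.
Proof. by rewrite /pospow; case: ifP => // _; exact: powR_ge0. Qed.

Lemma pospowM x k t : 0 < k -> pospow x (k * t) = k `^ (x - 1) * pospow x t.
Proof.
move=> k0; rewrite /pospow pmulr_rgt0//; case: ifP => t0; last by rewrite mulr0.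
by rewrite powRM// ltW.
Qed.

Definition gamma_density (x t : R) := expR (- t) * pospow x t.

Lemma gamma_density_ge0 x t : 0 <= gamma_density x t.
Proof. by rewrite mulr_ge0 ?expR_ge0 ?pospow_ge0. Qed.

Lemma measurable_gamma_density x : measurable_fun setT (gamma_density x).
Proof.
apply: measurable_funM; last exact: measurable_pospow.
by apply: measurableT_comp => //; exact: measurable_funN.
Qed.

Lemma integral_gamma_density x : 0 < x ->
  (\int[mu]_t (gamma_density x t)%:E = (euler_gamma x)%:E)%E.
Proof.
move=> x0.
have fin : (\int[mu]_(t in `]0%R, +oo[)
    (expR (- t) * t `^ (x - 1))%:E)%E \is a fin_num.
  by apply: integrable_fin_num (integrable_euler_gamma x0); exact: measurable_itv.
rewrite /euler_gamma /Rintegral fineK// [RHS]integral_mkcond.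
apply: eq_integral => t _; rewrite patchE mem_setE /= in_itv/= andbT.
by rewrite /gamma_density /pospow; case: ifP; rewrite ?mulr0.
Qed.

Definition beta_density (a c v : R) := pospow a v * pospow c (1 - v).

Lemma beta_density_ge0 a c v : 0 <= beta_density a c v.
Proof. by rewrite mulr_ge0 ?pospow_ge0. Qed.

Lemma measurable_beta_density a c : measurable_fun setT (beta_density a c).
Proof.
apply: measurable_funM; first exact: measurable_pospow.
by apply: measurableT_comp; [exact: measurable_pospow|exact: measurable_funB].
Qed.

(** For positive [u] this is the substitution s = u v; otherwise s and u - s
    cannot both be positive and both sides vanish. *)
Lemma integral_pospow_convolution a c u :
  (\int[mu]_s (pospow a s * pospow c (u - s))%:E =
   (pospow (a + c) u)%:E * \int[mu]_v (beta_density a c v)%:E)%E.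
Proof.
have [u0|u0] := leP u 0.
  have -> : pospow (a + c) u = 0 by rewrite /pospow ltNge u0.
  rewrite mul0e; apply: integral0_eq => s _.
  rewrite /pospow; have [s0|] := ltP 0 s; last by rewrite mul0r.
  by rewrite ifF ?mulr0//; apply/negP; lra.
rewrite -(ge0_integral_lebesgue_scale u0); first last.
- by move=> s; rewrite lee_fin mulr_ge0 ?pospow_ge0.
- apply/measurable_EFinP/measurable_funM; first exact: measurable_pospow.
  by apply: measurableT_comp; [exact: measurable_pospow|exact: measurable_funB].
have convE v : (pospow a (u * v) * pospow c (u - u * v))%:E =
    ((u `^ (a - 1) * u `^ (c - 1))%:E * (beta_density a c v)%:E)%E.
  have -> : u - u * v = u * (1 - v) by ring.
  by rewrite !pospowM// -EFinM /beta_density; congr EFin; ring.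
under eq_integral do rewrite convE.
rewrite ge0_integralZl//=; first last.
- by rewrite lee_fin mulr_ge0 ?powR_ge0.
- by move=> v _; rewrite lee_fin beta_density_ge0.
- by apply/measurable_EFinP; exact: measurable_beta_density.
rewrite muleA -EFinM /pospow u0; congr ((_%:E) * _)%E.
have powB x : u `^ (x - 1) = u `^ x / u.
  by rewrite powRB ?(gt_eqF u0) ?implybT// powRr1 ?ltW.
rewrite !powB powRD ?(gt_eqF u0) ?implybT//.
by field; rewrite gt_eqF.
Qed.

(** The two Euler integrals multiply to a double integral in which t = u - s is
    substituted; by Tonelli's theorem the integral in s can be taken first, and
    it is a convolution of powers. The Beta integral is an extended real here,
    as its finiteness is a consequence. *)
Lemma gamma_gamma_beta a c : 0 < a -> 0 < c ->
  ((euler_gamma a)%:E * (euler_gamma c)%:E =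
   (euler_gamma (a + c))%:E * \int[mu]_v (beta_density a c v)%:E)%E.
Proof.
move=> a0 c0; rewrite -(integral_gamma_density a0) -(integral_gamma_density c0).
rewrite -(integral_gamma_density (addr_gt0 a0 c0)).
have B0 : (0 <= \int[mu]_v (beta_density a c v)%:E)%E.
  by apply: integral_ge0 => v _; rewrite lee_fin beta_density_ge0.
have G0 : (0 <= \int[mu]_t (gamma_density c t)%:E)%E.
  by apply: integral_ge0 => v _; rewrite lee_fin gamma_density_ge0.
rewrite -ge0_integralZr//; first last.
- by move=> s _; rewrite lee_fin gamma_density_ge0.
- by apply/measurable_EFinP; exact: measurable_gamma_density.
pose f (su : measurableTypeR R * measurableTypeR R) :=
  (expR (- su.2) * (pospow a su.1 * pospow c (su.2 - su.1)))%:E.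
transitivity (\int[mu]_s \int[mu]_u f (s, u))%E.
  apply: eq_integral => s _.
  rewrite -(ge0_integral_lebesgue_shift s); first last.
  - by move=> t; rewrite lee_fin gamma_density_ge0.
  - by apply/measurable_EFinP; exact: measurable_gamma_density.
  rewrite -ge0_integralZl//; first last.
  - by rewrite lee_fin gamma_density_ge0.
  - by move=> t _; rewrite lee_fin gamma_density_ge0.
  - apply/measurable_EFinP; apply: measurableT_comp.
      exact: measurable_gamma_density.
    exact: measurable_funB.
  apply: eq_integral => u _; rewrite /f/= -EFinM; congr EFin.
  have -> : - u = - s + - (u - s) by ring.
  by rewrite expRD /gamma_density; ring.
have mf : measurable_fun setT f.
  apply/measurable_EFinP; apply: measurable_funM.
    by apply: measurableT_comp => //; apply: measurable_funN.
  apply: measurable_funM; apply: measurableT_comp => //; try exact: measurable_pospow.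
  exact: measurable_funB.
have f0 su : (0 <= f su)%E.
  by rewrite lee_fin !mulr_ge0 ?expR_ge0 ?pospow_ge0.
rewrite fubini_tonelli//.
transitivity (\int[mu]_u ((gamma_density (a + c) u)%:E *
    \int[mu]_v (beta_density a c v)%:E))%E.
  apply: eq_integral => u _.
  rewrite /f/=; under eq_integral do rewrite EFinM.
  rewrite ge0_integralZl//=; first last.
  - by move=> s _; rewrite lee_fin mulr_ge0 ?pospow_ge0.
  - apply/measurable_EFinP/measurable_funM; first exact: measurable_pospow.
    by apply: measurableT_comp; [exact: measurable_pospow|exact: measurable_funB].
  by rewrite integral_pospow_convolution muleA -EFinM.
rewrite ge0_integralZr//.
- by apply/measurable_EFinP; exact: measurable_gamma_density.
- by move=> s _; rewrite lee_fin gamma_density_ge0.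
Qed.

Lemma beta_densityE a c :
  (fun v => (beta_density a c v)%:E) =
  (fun v : R => (v `^ (a - 1) * (1 - v) `^ (c - 1))%:E) \_ `]0%R, 1%R[.
Proof.
apply/funext => v; rewrite patchE mem_setE /= in_itv/=.
rewrite /beta_density /pospow subr_gt0.
by case: (0 < v); case: (v < 1); rewrite /= ?mulr0 ?mul0r.
Qed.

(** Convergence comes for free: in [gamma_gamma_beta] the left-hand side is
    finite and the factor Gamma(a + c) is positive. *)
Lemma beta_integral a c : 0 < a -> 0 < c ->
  mu.-integrable `]0, 1[
    (EFin \o (fun v => v `^ (a - 1) * (1 - v) `^ (c - 1))) /\
  \int[mu]_(v in `]0, 1[) (v `^ (a - 1) * (1 - v) `^ (c - 1)) =
  euler_gamma a * euler_gamma c / euler_gamma (a + c).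
Proof.
move=> a0 c0; have := gamma_gamma_beta a0 c0.
have ac0 := euler_gamma_gt0 (addr_gt0 a0 c0).
rewrite beta_densityE -integral_mkcond -EFinM => eqB.
have intE : (\int[mu]_(v in `]0%R, 1%R[) (v `^ (a - 1) * (1 - v) `^ (c - 1))%:E =
    (euler_gamma a * euler_gamma c / euler_gamma (a + c))%:E)%E.
  rewrite mulrC EFinM eqB muleA -EFinM mulVf ?gt_eqF// mul1e//.
split; last by rewrite /Rintegral intE.
apply/integrableP; split.
  apply/measurable_EFinP/measurable_funM; first exact: measurable_powR_shift.
  apply: (@measurableT_comp _ _ _ _ _ _ (fun t : R => t `^ (c - 1))).
    exact: measurable_powR_shift.
  exact: measurable_funB.
under eq_integral do rewrite /= ger0_norm ?mulr_ge0 ?powR_ge0//.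
by rewrite intE ltry.
Qed.

End BetaGamma.

(** * Gamma and Beta away from the poles *)

Section GammaOffPoles.
Context {R : realType}.
Implicit Types a c x : R.

Lemma addr_gamma_shift_gt0 x : 0 < x + (gamma_shift x)%:R.
Proof. by have := truncnS_gt (1 - x); rewrite /gamma_shift -natr1; lra. Qed.

Lemma gamma_shift_eq0 x : 0 < x -> gamma_shift x = 0%N.
Proof. by move=> x0; apply/truncn0Pn; rewrite -ltNge; lra. Qed.

Lemma gamma_euler x : 0 < x -> gamma x = euler_gamma x.
Proof.
by move=> x0; rewrite /gamma gamma_shift_eq0// big_ord0 addr0 divr1.
Qed.

(** The shift jumps only where 1 - x is a positive integer, that is, at the poles
    of Gamma. *)
Lemma gamma_shift_near a : ~ gamma_pole a ->
  \forall x \near a, gamma_shift x = gamma_shift a.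
Proof.
move=> na; have [a0|a0] := ltP 0 a.
  near=> x; rewrite !gamma_shift_eq0//.
  by near: x; exact: lt_nbhsr.
pose n := gamma_shift a.
have /andP[na1 an1] : n%:R <= 1 - a < n.+1%:R by apply: truncn_itv; lra.
have {}na1 : n%:R < 1 - a.
  rewrite lt_neqAle na1 andbT; apply/eqP => na2; apply: na; exists n.-1.
  have n0 : (0 < n)%N by rewrite truncn_gt0; lra.
  by move: na2; rewrite -{1}(prednK n0) -natr1; lra.
near=> x; apply: truncn_def; apply/andP; split.
  suff : x < 1 - n%:R by lra.
  by near: x; apply: lt_nbhsl; lra.
suff : 1 - n.+1%:R < x by rewrite -/n; lra.
by near: x; apply: lt_nbhsr; lra.
Unshelve. all: by end_near. Qed.

Lemma prod_add_natr_neq0 a (n : nat) : ~ gamma_pole a ->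
  \prod_(k < n) (a + k%:R) != 0.
Proof.
move=> na; apply/prodf_neq0 => k _; apply/eqP => ak; apply: na.
by exists k; lra.
Qed.

Lemma gamma_neq0 a : ~ gamma_pole a -> gamma a != 0.
Proof.
move=> na; rewrite mulf_neq0 ?invr_eq0 ?prod_add_natr_neq0//.
by rewrite gt_eqF// euler_gamma_gt0// addr_gamma_shift_gt0.
Qed.

Lemma derivable_shift (f : R -> R) a c :
  derivable f (a + c) 1 -> derivable (fun x => f (x + c)) a 1.
Proof.
move=> df; have dg : is_derive a 1 (fun x : R => x + c) 1.
  exact: is_derive_shift.
have Df : is_derive (a + c) 1 f ('D_1 f (a + c)) by exact/derivableP.
by have [] := @is_derive1_comp R f (fun x => x + c) _ _ _ Df dg.
Qed.

(** Near a point that is not a pole the shift is constant, so Gamma is a shifted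
    Euler integral divided by a fixed polynomial with no zero there. *)
Lemma derivable_gamma a : ~ gamma_pole a -> derivable (@gamma R) a 1.
Proof.
move=> na; set n := gamma_shift a.
pose G x := euler_gamma (x + n%:R) * (\prod_(k < n) (x + k%:R))^-1.
apply: (@near_eq_derivable _ _ _ G).
  near=> x; rewrite /G /gamma.
  by have -> : gamma_shift x = n by near: x; exact: gamma_shift_near.
apply: derivableM.
  apply: derivable_shift; apply: derivable_euler_gamma; exact: addr_gamma_shift_gt0.
apply: derivableV; first exact: prod_add_natr_neq0.
elim: n {G} => [|n IH].
  by under eq_fun do rewrite big_ord0; exact: derivable_cst.
under eq_fun do rewrite big_ord_recr/=.
by apply: derivableM => //; exact: derivable_shift.
Unshelve. all: by end_near. Qed.

Lemma is_derive_gamma a : ~ gamma_pole a -> is_derive a 1 (@gamma R) (derive1 (@gamma R) a).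
Proof. by move=> na; rewrite derive1E; exact/derivableP/derivable_gamma. Qed.

Lemma betaC a c : beta a c = beta c a.
Proof. by rewrite /beta (mulrC (gamma a)) (addrC a). Qed.

Lemma derive1_beta a c : ~ gamma_pole a -> ~ gamma_pole (a + c) ->
  derive1 (fun s => beta s c) a =
    derive1 (@gamma R) a * gamma c / gamma (a + c)
    - gamma a * gamma c * derive1 (@gamma R) (a + c) / gamma (a + c) ^+ 2.
Proof.
move=> na nac.
have dg : is_derive a 1 (fun x : R => x + c) 1 by exact: is_derive_shift.
have dG := @is_derive1_comp R (@gamma R) (fun x => x + c) _ _ _ (is_derive_gamma nac) dg.
have dV := is_deriveV (gamma_neq0 nac : (@gamma R \o (fun x => x + c)) a != 0) dG.
have dM := is_deriveZ (gamma c) (is_deriveM (is_derive_gamma na) dV).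
have -> : (fun s => beta s c) = (fun s => gamma c *: (gamma s * (gamma (s + c))^-1)).
  by apply/funext => s; rewrite /beta /GRing.scale/=; ring.
rewrite derive1E; have [_ ->] := dM.
rewrite /GRing.scale/=; field.
exact: gamma_neq0.
Qed.

End GammaOffPoles.

(** * The dual Beta function *)

Section DualBeta.
Context {R : realType}.
Local Notation mu := (@lebesgue_measure R).

Lemma beta_integralE (a c : R) : 0 < a -> 0 < c ->
  \int[mu]_(t in `]0, 1[) (t `^ (a - 1) * (1 - t) `^ (c - 1)) = beta a c.
Proof.
move=> a0 c0; have [_ ->] := beta_integral a0 c0.
by rewrite /beta !gamma_euler// addr_gt0.
Qed.

(** Near [a] the function [beta] in its first variable is the Beta integral, whose
    derivative is obtained under the integral sign. *)
Lemma beta_integral_ln_l (a c : R) : 0 < a -> 0 < c ->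
  mu.-integrable `]0, 1[
    (EFin \o (fun t => t `^ (a - 1) * ln t * (1 - t) `^ (c - 1))) /\
  \int[mu]_(t in `]0, 1[) (t `^ (a - 1) * ln t * (1 - t) `^ (c - 1)) =
  derive1 (fun s => beta s c) a.
Proof.
move=> a0 c0.
have [|t|||int' der] := @is_derive_integral_powR R _
    (measurableTypeR R) mu `]0, 1[%classic (fun t => (1 - t) `^ (c - 1)) idfun a
    0 (a + 1) (measurable_itv _).
- exact: measurable_id.
- by rewrite /= in_itv/= => /andP[].
- by lra.
- by move=> s /andP[s0 _]; exact: (beta_integral s0 c0).1.
split=> //.
have dB : is_derive a 1 (fun s => beta s c)
    (\int[mu]_(t in `]0, 1[) (t `^ (a - 1) * ln t * (1 - t) `^ (c - 1))).
  apply: near_eq_is_derive der; near=> s; apply: beta_integralE => //.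
  by near: s; exact: lt_nbhsr.
by rewrite derive1E; have [_ ->] := dB.
Unshelve. all: by end_near. Qed.

Lemma beta_integral_ln_r (a c : R) : 0 < a -> 0 < c ->
  mu.-integrable `]0, 1[
    (EFin \o (fun t => (1 - t) `^ (c - 1) * ln (1 - t) * t `^ (a - 1))) /\
  \int[mu]_(t in `]0, 1[) ((1 - t) `^ (c - 1) * ln (1 - t) * t `^ (a - 1)) =
  derive1 (beta a) c.
Proof.
move=> a0 c0.
have [|t|||int' der] := @is_derive_integral_powR R _
    (measurableTypeR R) mu `]0, 1[%classic (fun t => t `^ (a - 1)) (fun t => 1 - t) c
    0 (c + 1) (measurable_itv _).
- exact: measurable_funB.
- by rewrite /= in_itv/= => /andP[_ t1]; lra.
- by lra.
- move=> s /andP[s0 _]; apply: eq_integrable (beta_integral a0 s0).1 => //.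
  by move=> t _; rewrite /= mulrC.
split=> //.
have dB : is_derive c 1 (beta a)
    (\int[mu]_(t in `]0, 1[) ((1 - t) `^ (c - 1) * ln (1 - t) * t `^ (a - 1))).
  apply: near_eq_is_derive der; near=> s; rewrite -beta_integralE//.
    by apply: eq_Rintegral => t _; rewrite mulrC.
  by near: s; exact: lt_nbhsr.
by rewrite derive1E; have [_ ->] := dB.
Unshelve. all: by end_near. Qed.

(** When a and c are positive, the dual part of the integrand is a combination of
    the two logarithmic integrands with coefficients b and d, so that the
    integral agrees with the formula that is the definition otherwise. *)
Lemma dual_betaE (a b c d : R) :
  dual_beta (Dual a b) (Dual c d) =
  Dual (beta a c) (b * derive1 (fun s => beta s c) a + d * derive1 (beta a) c).
Proof.
rewrite /dual_beta /=; case: ifPn => [/andP[a0 c0]|//].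
have [intl El] := beta_integral_ln_l a0 c0.
have [intr Er] := beta_integral_ln_r a0 c0.
rewrite /dual_integral; congr Dual; first exact: beta_integralE.
rewrite -El -Er -!RintegralZl// -RintegralD//; first last.
- exact: (integrableZl _ d intr).
- exact: (integrableZl _ b intl).
apply: eq_Rintegral => t _ /=.
by rewrite !subr0; ring.
Qed.

End DualBeta.

Theorem mainTheorem3 (R : realType) (a b c d : R)
    (ha : ~ gamma_pole a) (hc : ~ gamma_pole c) (hac : ~ gamma_pole (a + c)) :
  dual_beta (Dual a b) (Dual c d) =
    dual_gamma (Dual a b) * dual_gamma (Dual c d)
      / dual_gamma (Dual a b + Dual c d).
Proof.
have gac := gamma_neq0 hac.
(* The denominator is invertible because its real part is nonzero. *)
have gU : dual_gamma (Dual a b + Dual c d) \is a GRing.unit by [].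
apply: (canRL (mulrK gU)); rewrite dual_betaE.
have -> : derive1 (beta a) c = derive1 (fun s => beta s a) c.
  by congr (derive1 _ c); apply/funext => s; exact: betaC.
rewrite !derive1_beta ?(addrC c)//.
congr Dual => /=; first by rewrite /beta divfK.
by rewrite /beta; field.
Qed.
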